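(* Let $\lambda$ be a nonzero real number. For all integers $k,r\geq 0$, $$\phi_{k,\lambda}^{(r)}=\frac{1}{e}\sum_{n=0}^\infty\frac{1}{n!}(n+r)_{k,\lambda}.$$
   Context: Degenerate falling factorials: $(x)_{0,\lambda}=1$, $(x)_{k,\lambda}=x(x-\lambda)\cdots(x-(k-1)\lambda)$ for $k\ge1$; ordinary falling factorials $(x)_0=1$, $(x)_k=x(x-1)\cdots(x-k+1)$. Degenerate $r$-Stirling numbers of the second kind are defined by $(x+r)_{n,\lambda}=\sum_{k=0}^n \begin{Bmatrix}n+r \\ k+r \end{Bmatrix}_{r,\lambda}(x)_k$ ($n\ge0$); the degenerate $r$-Bell polynomials are $\phi_{n,\lambda}^{(r)}(x)=\sum_{k=0}^n \begin{Bmatrix}n+r \\ k+r \end{Bmatrix}_{r,\lambda}x^k$, and the degenerate $r$-Bell numbers are $\phi_{n,\lambda}^{(r)}=\phi_{n,\lambda}^{(r)}(1)$. *)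

(* Defs.v *)
From HB Require Import structures.
From mathcomp Require Import all_boot all_order all_algebra.
From mathcomp Require Import all_classical all_reals all_analysis.
From mathcomp Require Import ring.

Set Implicit Arguments.
Unset Strict Implicit.
Unset Printing Implicit Defensive.
Import Order.TTheory GRing.Theory Num.Theory.
Local Open Scope classical_set_scope.
Local Open Scope ring_scope.

Definition falling (R : realType) (x : R) (k : nat) : R :=
  \prod_(i < k) (x - i%:R).

Definition degenerate_falling (R : realType) (lambda x : R) (k : nat) : R :=
  \prod_(i < k) (x - i%:R * lambda).

(* The expansion only constrains the coefficients of index k <= n; the other
   ones are set to 0, so that exactly one sequence satisfies the predicate. *)
Definition degenerate_r_stirling2_expansion (R : realType) (lambda : R)
    (r n : nat) (S : nat -> R) : Prop :=
  (forall x : R, degenerate_falling lambda (x + r%:R) n =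
     \sum_(k < n.+1) S k * falling x k) /\
  (forall k : nat, (n < k)%N -> S k = 0).

(* [degenerate_r_stirling2 lambda r n k] is the number written
   {n + r, k + r}_{r, lambda}: the indices n and k are not shifted by r.
   [xget] picks the unique such sequence (existence and uniqueness are proved
   below), its default value 0 is never used. *)
Definition degenerate_r_stirling2 (R : realType) (lambda : R) (r n : nat) :
    nat -> R :=
  xget (fun=> 0) [set S | degenerate_r_stirling2_expansion lambda r n S].

Definition degenerate_r_bell_poly (R : realType) (lambda : R) (r n : nat)
    (x : R) : R :=
  \sum_(k < n.+1) degenerate_r_stirling2 lambda r n k * x ^+ k.

Definition degenerate_r_bell (R : realType) (lambda : R) (r n : nat) : R :=
  degenerate_r_bell_poly lambda r n 1.

Lemma degenerate_r_stirling2_exists (R : realType) (lambda : R) (r n : nat) :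
  exists S, degenerate_r_stirling2_expansion lambda r n S.
Proof.
elim: n => [|n [S [ES S0]]].
  exists (fun k => (k == 0%N)%:R); split=> [x|[]//].
  by rewrite big_ord_recl big_ord0 /degenerate_falling /falling !big_ord0 mul1r
    addr0.
pose c k : R := k%:R + r%:R - n%:R * lambda.
exists (fun k => (if k is j.+1 then S j else 0) + c k * S k).
split=> [x|[|k] // nk]; last by rewrite !S0 ?mulr0 ?addr0 // ltnW.
rewrite /degenerate_falling big_ord_recr /= -/(degenerate_falling _ _ _) ES.
under [RHS]eq_bigr do rewrite mulrDl.
rewrite big_split /= [X in _ = X + _]big_ord_recl mul0r add0r.
rewrite [X in _ = _ + X]big_ord_recr /=.
rewrite S0 // mulr0 mul0r addr0 -big_split /= mulr_suml.
apply: eq_bigr => i _.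
rewrite /bump /= add1n /falling big_ord_recr /= -/(falling x i) /c.
ring.
Qed.

Lemma degenerate_r_stirling2_unique (R : realType) (lambda : R) (r n : nat)
    (S T : nat -> R) :
  degenerate_r_stirling2_expansion lambda r n S ->
  degenerate_r_stirling2_expansion lambda r n T -> S = T.
Proof.
move=> [ES S0] [ET T0]; apply/funext => k.
elim/ltn_ind: k => k IH.
have [nk|kn] := ltnP n k; first by rewrite S0 ?T0.
have kn' : (k < n.+1)%N by [].
have fgt (i : nat) : (k < i)%N -> falling k%:R i = 0 :> R.
  by move=> ki; apply/eqP/prodf_eq0; exists (Ordinal ki); rewrite //= subrr.
have fk : falling k%:R k != 0 :> R.
  apply/prodf_neq0 => i _; rewrite subr_eq0 eqr_nat.
  by rewrite gtn_eqF.
have := ET k%:R; rewrite ES (bigD1 (Ordinal kn')) //=.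
rewrite [RHS](bigD1 (Ordinal kn')) //=.
rewrite (eq_bigr (fun i : 'I_n.+1 => T i * falling k%:R i)) =>
  [/addIr/(mulIf fk)//|i].
rewrite -val_eqE /= neq_ltn => /orP[ik|ki]; first by rewrite IH.
by rewrite fgt // !mulr0.
Qed.

Lemma degenerate_r_stirling2P (R : realType) (lambda : R) (r n : nat) :
  degenerate_r_stirling2_expansion lambda r n
    (degenerate_r_stirling2 lambda r n).
Proof.
have [S ES] := degenerate_r_stirling2_exists lambda r n.
by rewrite /degenerate_r_stirling2; case: xgetP => [_ -> //|/(_ S)].
Qed.

(* Main.v *)
(* The numbers 1/n! (n)_j vanish for n < j and equal 1/(n-j)! otherwise, so
   they sum to e for every j; expanding (n + r)_{k,lambda} in the basis (n)_j
   then gives a finite combination of series each of which sums to e. *)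
Require Import Defs.
From HB Require Import structures.
From mathcomp Require Import all_boot all_order all_algebra.
From mathcomp Require Import all_classical all_reals all_analysis.

Set Implicit Arguments.
Unset Strict Implicit.
Unset Printing Implicit Defensive.
Import Order.TTheory GRing.Theory Num.Theory.
Import numFieldNormedType.Exports.
Local Open Scope classical_set_scope.
Local Open Scope ring_scope.

Lemma falling_nat_eq0 (R : realType) (n j : nat) :
  (n < j)%N -> falling n%:R j = 0 :> R.
Proof.
by move=> nj; apply/eqP/prodf_eq0; exists (Ordinal nj); rewrite //= subrr.
Qed.

(** This is [ffact_fact] carried over to [R]. Writing the argument as [n + j] keeps every factor
    [n + j - i] with [i < j] free of truncated subtraction. *)
Lemma falling_nat_fact (R : realType) (n j : nat) :
  (n`!)%:R * falling (n + j)%:R j = (n + j)`!%:R :> R.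
Proof.
rewrite -(ffact_fact (leq_addl n j)) addnK natrM mulrC; congr (_ * _).
rewrite ffact_prod natr_prod; apply: eq_bigr => i _.
by rewrite natrB// (leq_trans (ltnW (ltn_ord i))) ?leq_addl.
Qed.

Lemma cvg_series_falling (R : realType) (j : nat) :
  series (fun n : nat => (n`!%:R)^-1 * falling n%:R j : R) @ \oo --> expR 1.
Proof.
(* Partial sums up to [n + j] have the same limit, and they equal the exponential partial sums up to
   [n]. *)
rewrite -(cvg_shiftn j).
rewrite (_ : [sequence _]_n = series (exp_coeff (1 : R))).
  (* [expR 1] is by definition the limit of this series. *)
  exact: is_cvg_series_exp_coeff.
apply/funext => n; rewrite /series /=.
rewrite (@big_cat_nat _ _ _ j) ?leq_addl//= big_nat big1 ?add0r; last first.
  by move=> i /andP[_ ij]; rewrite falling_nat_eq0 // mulr0.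
rewrite -{1}[j]add0n big_addn addnK; apply: eq_bigr => i _.
rewrite /exp_coeff /= expr1n mul1r.
have fact_neq0 (m : nat) : m`!%:R != 0 :> R by rewrite pnatr_eq0 -lt0n fact_gt0.
apply: (mulfI (fact_neq0 i)).
by rewrite mulrCA falling_nat_fact !mulVf ?divff.
Qed.

Theorem theorem7 (R : realType) (lambda : R) (hlambda : lambda != 0)
    (k r : nat) :
  cvgn (series (fun n : nat =>
    (n`!%:R)^-1 * degenerate_falling lambda (n + r)%:R k)) /\
  degenerate_r_bell lambda r k =
    (expR 1)^-1 * limn (series (fun n : nat =>
      (n`!%:R)^-1 * degenerate_falling lambda (n + r)%:R k)).
Proof.
have [SE _] := degenerate_r_stirling2P lambda r k.
set S := degenerate_r_stirling2 lambda r k in SE.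
set u := series _.
(* The expansion is applied to each partial sum, so only finite sums are exchanged. *)
have uE : u = fun N => \sum_(j < k.+1)
    S j * series (fun n : nat => (n`!%:R)^-1 * falling n%:R j) N.
  apply/funext => N; rewrite /u /series /=.
  under [RHS]eq_bigr do rewrite mulr_sumr.
  rewrite exchange_big; apply: eq_bigr => n _.
  by rewrite natrD SE mulr_sumr; apply: eq_bigr => j _; rewrite mulrCA.
have u_cvg : u @ \oo --> degenerate_r_bell lambda r k * expR 1.
  rewrite uE /degenerate_r_bell /degenerate_r_bell_poly mulr_suml.
  (* The limit passes through the finite sum over [j], whose terms tend to [S j * expR 1]. *)
  apply: (cvg_big (op := +%R) add_continuous) => // j _; rewrite expr1n mulr1.
  by apply: cvgM; [exact: cvg_cst|exact: cvg_series_falling].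
split; first by apply/cvg_ex; eexists; exact: u_cvg.
by rewrite (cvg_lim _ u_cvg)// mulrC mulfK// gt_eqF// expR_gt0.
Qed.
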